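(* Let $S_{l_{1},\ldots,l_{k}}$ denote a spider graph with junction vertex $v$, pendant vertices $u_{1},\ldots,u_{k}$, where $k\geq 2$ and for $i=1,\ldots,k$, the length of the path from $v$ to $u_{i}$ is $l_{i}\geq 1$. Then, the number of minimal forts satisfies \[ \lvert\mathcal{F}_{S_{l_{1},\ldots,l_{k}}}\rvert = \prod_{i=1}^{k}\lvert\mathcal{F}_{P_{l_{i}-1}}\rvert + \sum_{i=1}^{k}\lvert\mathcal{F}_{P_{l_{i}-2}}\rvert\prod_{j\neq i}\lvert\mathcal{F}_{P_{l_{j}-1}}\rvert+\sum_{1\leq i<j\leq k}\lvert\mathcal{F}_{P_{l_{i}}}\rvert\lvert\mathcal{F}_{P_{l_{j}}}\rvert, \] where $\lvert\mathcal{F}_{P_{-1}}\rvert=1$ and $\lvert\mathcal{F}_{P_{0}}\rvert=0$.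
   Context: For a graph $G=(V,E)$, a non-empty subset $F\subseteq V$ is a fort if no vertex outside $F$ has exactly one neighbor in $F$; a fort is minimal if every proper subset is not a fort. $\mathcal{F}_{G}$ denotes the collection of all minimal forts of $G$. $P_{n}$ is the path graph on $n$ vertices. A spider graph is a tree with exactly one junction vertex (vertex of degree at least 3). *)

(* Defs.v *)
From mathcomp Require Import all_boot all_order all_algebra.

Set Implicit Arguments.
Unset Strict Implicit.
Unset Printing Implicit Defensive.

Section Graphs.
Variables (T : finType) (e : rel T).

Definition simple_graph : Prop := symmetric e /\ irreflexive e.

Definition neighbors (x : T) : {set T} := [set y | e x y].
Definition degree (x : T) : nat := #|neighbors x|.
Definition pendant (x : T) : bool := degree x == 1.
Definition junction (x : T) : bool := 2 < degree x.

Definition connected_graph : Prop := forall x y : T, connect e x y.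

(* In an irreflexive symmetric relation, a [ucycle] of size 2 is a single edge
   traversed back and forth; graph cycles are those with at least 3 vertices. *)
Definition acyclic_graph : Prop :=
  forall c : seq T, 2 < size c -> ~~ ucycleb e c.

Definition tree : Prop :=
  [/\ simple_graph, connected_graph & acyclic_graph].

Definition has_path_of_length (x y : T) (n : nat) : Prop :=
  exists p : seq T,
    [/\ path e x p, uniq (x :: p), last x p = y & size p = n].

Definition fort (F : {set T}) : bool :=
  (F != set0) && [forall x, (x \notin F) ==> (#|neighbors x :&: F| != 1)].

Definition minimal_forts : {set {set T}} := [set F | minset fort F].

(* For [2 < k] the third field says that [v] is the one and only junction
   vertex.  For [k = 2] the spider degenerates to a path, which has no vertex
   of degree at least 3, and [v] is then an internal vertex of that path
   (as soon as the leg lengths [l i] are positive). *)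
Record spider (k : nat) (l : 'I_k -> nat) (v : T) (u : 'I_k -> T) : Prop :=
  Spider {
    spider_tree : tree;
    spider_pendant_inj : injective u;
    spider_junction : forall x, junction x = (2 < k) && (x == v);
    spider_pendant : forall x, pendant x = (x \in codom u);
    spider_length : forall i, has_path_of_length v (u i) (l i)
  }.

End Graphs.

Definition path_graph (n : nat) : rel 'I_n :=
  fun i j => (i.+1 == j :> nat) || (j.+1 == i :> nat).

(* Indexed by [int] so that [P_(-1)] makes sense; by convention its count is 1
   (the value at other negative indices is irrelevant), and that of [P_0]
   is 0. *)
Definition num_path_forts (n : int) : nat :=
  match n with
  | Posz 0 => 0
  | Posz m => #|minimal_forts (@path_graph m)|
  | Negz _ => 1
  end.

(* Main.v *)
Require Import Defs.
From mathcomp Require Import all_boot all_order all_algebra.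
From mathcomp Require Import zify.

(* Encode a fort by its membership bits along each leg, read outwards from the
   junction [v].  The fort condition inside a leg is local: an outside vertex
   has both or none of its two neighbours in the fort, and minimality forbids
   three consecutive members.  If [v] is in a minimal fort, every leg is a
   minimal pattern following a member, and at most one leg starts with a
   member: two such legs alone, without [v], already form a smaller fort.  A
   leg of length l that starts with a non-member gives a minimal fort of
   P_(l-1), the others one of P_(l-2).  If [v] is not in the fort, each leg is
   empty or starts with a member, and a minimal fort meets exactly two legs,
   in minimal forts of P_l. *)

Set Implicit Arguments.
Unset Strict Implicit.
Unset Printing Implicit Defensive.

(** * Fort patterns along a single chain *)

(* [b] is the status of the vertex before the sequence; the vertex after its
   end does not exist, hence counts as lying outside the fort. *)
Fixpoint fort_bits (b : bool) (s : bitseq) : bool :=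
  if s is c :: s' then (c || (b == head false s')) && fort_bits c s' else true.

(* Membership patterns after a vertex of the fort: such a pattern is a fort iff
   it never skips two vertices in a row and keeps the last one, and no vertex
   can be spared iff no three consecutive vertices (the preceding one included)
   are kept. *)
Fixpoint minimal_tail (s : bitseq) : bool :=
  match s with
  | [::] | [:: true] => true
  | false :: true :: s' | true :: false :: true :: s' => minimal_tail s'
  | _ => false
  end.

Definition minimal_bits (s : bitseq) : bool :=
  if s is true :: s' then minimal_tail s' else false.

Lemma fort_bitsP b s :
  reflect (forall j, j < size s -> nth false s j = false ->
             nth false (b :: s) j = nth false s j.+1)
          (fort_bits b s).
Proof.
elim: s b => [|c s IH] b /=; first by apply: ReflectT.
apply: (iffP andP) => [[cb /IH sP] [|j] /= j_s cF | sP].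
- by move: cb; rewrite cF nth0 => /eqP.
- exact: sP.
split; last by apply/IH => j; apply: (sP j.+1).
case: c sP => //= sP; apply/eqP; rewrite -nth0; exact: (sP 0).
Qed.

(** Two consecutive non-members force the next vertex out as well, so emptiness spreads along the
    whole chain. *)
Lemma fort_bits_false_head s :
  fort_bits false s -> ~~ head false s -> s = nseq (size s) false.
Proof.
elim: s => //= [[|]] // s IH /andP[/eqP s0 s_ok] _.
by congr (_ :: _); apply: IH => //; rewrite -s0.
Qed.

Lemma fort_bits_nseq n : fort_bits false (nseq n false).
Proof. by elim: n => //= -[|n]. Qed.

Lemma minimal_tail_fort s : minimal_tail s -> fort_bits true s.
Proof.
have [n] := ubnP (size s); elim: n s => // n IH.
case=> [|[] [|[] s]] //=; first by case: s => [|[] s] //= ?; apply: IH; lia.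
by move=> ?; apply: IH; lia.
Qed.

(** Induction over the blocks of [s]. In [false, true] the first bit of [t] is cleared by inclusion,
    and a vertex skipped after a member must be followed by a member. In [true, false, true] the
    first vertex cannot be dropped, since only its predecessor would be in the fort. Each block ends
    with a member, so the argument restarts. *)
Lemma minimal_tail_min s t :
  minimal_tail s -> fort_bits true t -> all2 implb t s -> t = s.
Proof.
have [n] := ubnP (size s); elim: n s t => // n IH.
case=> [|[] [|[] s]] t //= s_n.
- by case: t.
- by case: t => [|[] []].
- case: s s_n => [|[] s] //= s_n.
  case: t => [|[] [|[] [|[] t]]]; rewrite //= ?andbF //= => s_min t_ok ts.
  by congr [:: _, _, _ & _]; apply: IH => //; lia.
- case: t => [|[] [|[] t]]; rewrite //= ?andbF //= => s_min t_ok ts.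
  by congr [:: _, _ & _]; apply: IH => //; lia.
Qed.

Lemma minimal_tail_exists s :
  fort_bits true s -> exists2 t, minimal_tail t & all2 implb t s.
Proof.
have [n] := ubnP (size s); elim: n s => // n IH.
case=> [|[] [|[] s]]; rewrite ?ltnS /=.
- by exists [::].
- by exists [:: true].
- by move=> /ltnW n_s /(IH _ n_s)[t]; exists [:: false, true & t].
- case: s => [|[] s] //= /ltnW/ltnW n_s /(IH _ n_s)[t].
  by exists [:: true, false, true & t].
- by [].
- by move=> /ltnW n_s /(IH _ n_s)[t]; exists [:: false, true & t].
- by case: s.
Qed.

Lemma minimal_bits_min s t :
  minimal_bits s -> fort_bits false t -> head false t -> all2 implb t s -> t = s.
Proof.
by case: s t => [//|[] // s] [|[] t] //= ? ? _ ?; congr (_ :: _); apply: minimal_tail_min.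
Qed.

Lemma minimal_bits_exists s : fort_bits false s -> head false s ->
  exists2 t, minimal_bits t & all2 implb t s.
Proof.
by case: s => [|[] s] //= /minimal_tail_exists[t] ? ? _; exists (true :: t).
Qed.

Lemma minimal_bits_fort s : minimal_bits s -> fort_bits false s.
Proof. by case: s => [|[] s] //= /minimal_tail_fort. Qed.

Lemma minimal_bits_head s : minimal_bits s -> head false s.
Proof. by case: s => [|[] s]. Qed.

(** * Counting patterns of a given length *)

Definition count_bits (A : pred bitseq) (n : nat) : nat :=
  #|[set t : n.-tuple bool | A t]|.

Lemma eq_count_bits (A B : pred bitseq) n :
  (forall s, size s = n -> A s = B s) -> count_bits A n = count_bits B n.
Proof. by move=> AB; apply: eq_card => t; rewrite !inE AB ?size_tuple. Qed.

Lemma count_bits0 A : count_bits A 0 = A [::].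
Proof.
rewrite /count_bits; case AP: (A [::]).
- have -> : [set t : 0.-tuple bool | A t] = setT.
    by apply/setP=> t; rewrite !inE tuple0.
  by rewrite cardsT card_tuple.
apply/eqP; rewrite cards_eq0; apply/eqP/setP=> t.
by rewrite !inE tuple0.
Qed.

Lemma count_bitsS A n : count_bits A n.+1 =
  count_bits (A \o cons true) n + count_bits (A \o cons false) n.
Proof.
rewrite /count_bits -[X in _ = X + _](@card_imset _ _ (cons_tuple true)); last first.
  by move=> t1 t2 /(congr1 val) [] /val_inj.
rewrite -[X in _ = _ + X](@card_imset _ _ (cons_tuple false)); last first.
  by move=> t1 t2 /(congr1 val) [] /val_inj.
set X := imset _ _; set Y := imset _ _.
have XY : [disjoint X & Y].
  apply/pred0P=> t /=; apply/negP => /andP[/imsetP[a _ ->] /imsetP[b _]].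
  by move/(congr1 val).
have /eqP <- : #|X :|: Y| == #|X| + #|Y|  by rewrite (leq_card_setU X Y).2.
apply: eq_card => t; rewrite !inE; case/tupleP: t => [[] t] /=.
- apply/idP/orP => [At|[] /imsetP[s]]; rewrite ?inE.
  + by left; apply/imsetP; exists t; rewrite ?inE.
  + by move=> As /(congr1 val) [->].
  + by move=> As /(congr1 val).
- apply/idP/orP => [At|[] /imsetP[s]]; rewrite ?inE.
  + by right; apply/imsetP; exists t; rewrite ?inE.
  + by move=> As /(congr1 val).
  + by move=> As /(congr1 val) [->].
Qed.

Lemma count_bits_pred0 n : count_bits pred0 n = 0.
Proof. by apply: eq_card0 => t; rewrite inE. Qed.

Lemma count_bits_nseq n b : count_bits (pred1 (nseq n b)) n = 1.
Proof.
rewrite /count_bits -(cards1 (nseq_tuple n b)); apply: eq_card => t.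
by rewrite !inE -val_eqE.
Qed.

(** A vertex skipped right after a member must be followed by a member, so the remaining [n] bits
    form a minimal pattern of their own. *)
Lemma count_minimal_tail_skip n :
  count_bits (fun s => minimal_tail s && ~~ head false s) n.+1 =
  count_bits minimal_bits n.
Proof.
rewrite count_bitsS [X in X + _](@eq_count_bits _ pred0) => [|s _ /=].
  rewrite count_bits_pred0; apply: eq_count_bits => -[|[] s] //= _.
  by rewrite andbT.
by rewrite andbF.
Qed.

(** The single pattern here is what the convention of one fort for [P_(-1)] accounts for. *)
Lemma count_minimal_tail_take1 :
  count_bits (fun s => minimal_tail s && head false s) 1 = 1.
Proof. by rewrite count_bitsS !count_bits0. Qed.

(** Three members in a row are excluded, so keeping the first vertex forces skipping the second; the
    remaining [n] bits then start afresh with a member. *)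
Lemma count_minimal_tail_take n :
  count_bits (fun s => minimal_tail s && head false s) n.+2 =
  count_bits minimal_bits n.
Proof.
rewrite count_bitsS addnC [X in X + _](@eq_count_bits _ pred0) => [|s _ /=].
  rewrite count_bits_pred0 add0n count_bitsS [X in X + _](@eq_count_bits _ pred0) => [|s _ //=].
  by rewrite count_bits_pred0; apply: eq_count_bits => -[|[] s] //= _;
     rewrite andbT.
by rewrite andbF.
Qed.

(** * From vertex sets to patterns along chains *)

Definition trace (T : finType) (F : {set T}) (s : seq T) : bitseq :=
  [seq x \in F | x <- s].

Section Chains.
Variables (T : finType) (e : rel T).
Implicit Types (F : {set T}) (s : seq T).

Lemma fortP F : reflect
  (F != set0 /\ forall x, x \notin F -> #|neighbors e x :&: F| != 1)
  (fort e F).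
Proof.
apply: (iffP andP) => -[F0 fortF]; split=> //.
  by move=> x xF; move/forallP/(_ x)/implyP: fortF; apply.
by apply/forallP => x; apply/implyP/fortF.
Qed.

(** Here [a] and [c] are the vertices before and after [x] on a chain, [None] standing for a missing
    one. They are distinct unless both are missing, so no neighbour is counted twice. *)
Lemma card_neighborsI x F (a c : option T) :
    (forall z, e x z = (Some z == a) || (Some z == c)) ->
    (a = c -> a = None) ->
  #|neighbors e x :&: F| = oapp (mem F) false a + oapp (mem F) false c.
Proof.
move=> exE ac; pose s := [seq z <- pmap id [:: a; c] | z \in F].
have -> : #|neighbors e x :&: F| = #|s|.
  apply: eq_card => z; rewrite !inE mem_filter mem_pmap exE andbC.
  by rewrite map_id !inE.
have /card_uniqP -> : uniq s.
  apply: filter_uniq; case: a c ac {exE s} => [a|] [c|] //= ac.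
  by rewrite inE andbT; apply/eqP => E; have := ac (congr1 Some E).
rewrite size_filter; case: a c {s ac exE} => [a|] [c|] //=; lia.
Qed.

(* The vertices of [s] form a chain hanging from [o], where [o = None]
   means that the first vertex of [s] is an end of the chain too. *)
Definition chain (o : option T) s : Prop :=
  uniq s /\ (o \notin map Some s) /\
  forall x0 j z, j < size s ->
    e (nth x0 s j) z = (Some z == nth None (o :: map Some s) j)
                    || (Some z == nth None (map Some s) j.+1).

(** The number of neighbours in [F] is the sum of the two adjacent bits, and this differs from 1
    exactly when the bits agree. *)
Lemma chain_fortP o s F : chain o s -> reflect
  (forall x, x \in s -> x \notin F -> #|neighbors e x :&: F| != 1)
  (fort_bits (oapp (mem F) false o) (trace F s)).
Proof.
move=> [s_uniq [os eE]]; pose f := oapp (mem F) false.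
have trE : trace F s = map f (map Some s) by rewrite -map_comp.
have fE L j : nth false (map f L) j = f (nth None L j).
  case: (ltnP j (size L)) => Lj; first exact: nth_map.
  by rewrite !nth_default ?size_map.
have cardE x0 j : j < size s -> #|neighbors e (nth x0 s j) :&: F| =
    nth false (f o :: trace F s) j + nth false (trace F s) j.+1.
  move=> js; rewrite trE -map_cons !fE; apply: card_neighborsI => [z|].
    exact: eE.
  case: (ltnP j.+1 (size s)) => js1; last first.
    by move->; rewrite nth_default ?size_map.
  (* Both neighbours are entries of [o :: map Some s], at positions [j] and [j.+2]; this list has no
     repetition. *)
  move/eqP; rewrite -[X in _ == X]/(nth None (o :: map Some s) j.+2).
  rewrite nth_uniq /= ?size_map //; [by lia|by lia|].
  by rewrite os map_inj_uniq // => ? ? [].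
have memE x0 j : j < size s -> (nth x0 s j \in F) = nth false (trace F s) j.
  by move=> js; rewrite (nth_map x0).
apply: (iffP (fort_bitsP _ _)) => H.
  move=> x xs; rewrite -(nth_index x xs) memE ?index_mem // cardE ?index_mem //.
  move/negbTE/H; rewrite size_map index_mem => /(_ xs) ->.
  by case: nth.
move=> j; rewrite size_map => js jF.
have x0 : T by case: (s) js.
have := H (nth x0 s j); rewrite mem_nth // memE // jF cardE // => /(_ isT isT).
by do 2!case: (nth false _ _).
Qed.

End Chains.

(** * Vertex sets as families of patterns *)

Section Traces.
Variables (T I : finType) (q : I -> seq T).
Hypotheses (q_uniq : forall i, uniq (q i))
  (q_disj : forall i j x, x \in q i -> x \in q j -> i = j)
  (q_cover : forall x, exists i, x \in q i).
Implicit Types F : {set T}.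

Lemma trace_surj (t : I -> bitseq) : (forall i, size (t i) = size (q i)) ->
  exists F, forall i, trace F (q i) = t i.
Proof.
move=> t_size.
exists [set x | [exists i, (x \in q i) && nth false (t i) (index x (q i))]] => i.
apply: (@eq_from_nth _ false) => [|j]; rewrite size_map ?t_size // => jq.
have x0 : T by case: (q i) jq.
rewrite (nth_map x0) // inE; apply/existsP/idP => [[i' /andP[jq']]|ti].
  by rewrite -(q_disj (mem_nth x0 jq) jq') index_uniq.
by exists i; rewrite mem_nth // index_uniq.
Qed.

Lemma trace_subset F F' :
  reflect (forall i, all2 implb (trace F (q i)) (trace F' (q i))) (F \subset F').
Proof.
have E i : all2 implb (trace F (q i)) (trace F' (q i)) =
           all (fun x => (x \in F) ==> (x \in F')) (q i).
  by elim: (q i) => //= x s ->.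
apply: (iffP subsetP) => [FF' i|H x xF].
  by rewrite E; apply/allP => x _; apply/implyP/FF'.
by have [i xi] := q_cover x; have := H i; rewrite E => /allP/(_ x xi)/implyP; apply.
Qed.

Lemma trace_inj F F' : (forall i, trace F (q i) = trace F' (q i)) -> F = F'.
Proof.
move=> FF'; apply/setP => x; have [i xi] := q_cover x.
by have /eq_in_map/(_ x xi) := FF' i.
Qed.

(** The sequences [q i] partition the vertices, so the traces can be prescribed independently and
    the count is a product. *)
Lemma card_trace (A : I -> pred bitseq) :
  #|[set F | [forall i, A i (trace F (q i))]]| =
  \prod_i count_bits (A i) (size (q i)).
Proof.
pose X i := [set t : (size (q i)).-tuple bool | A i t].
rewrite -(cardsXn X).
pose h F : {dffun forall i, (size (q i)).-tuple bool} :=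
  [ffun i => map_tuple (mem F) (in_tuple (q i))].
rewrite -(@card_imset _ _ h); last first.
  move=> F F' /ffunP hE; apply: trace_inj => i.
  by have /(congr1 val) := hE i; rewrite !ffunE.
apply: eq_card => t; apply/imsetP/setXnP => [[F] | tX].
  by rewrite inE => /forallP AF -> i; rewrite inE ffunE; apply: AF.
have [|F FE] := @trace_surj (fun i => t i); first by move=> i; rewrite size_tuple.
exists F; first by rewrite inE; apply/forallP => i; rewrite FE; have := tX i; rewrite inE.
by apply/ffunP => i; apply/val_inj; rewrite ffunE /= -FE.
Qed.

End Traces.

(** * Minimal forts of paths *)

Lemma path_chain n : chain (@path_graph n) None (enum 'I_n).
Proof.
split; first exact: enum_uniq.
split; first by apply/mapP => -[].
move=> x0 j z; rewrite size_enum_ord => jn.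
rewrite /path_graph nth_enum_ord // orbC.
have E i : i < n -> (Some z == nth None (map Some (enum 'I_n)) i) = (i == z :> nat).
  move=> i_n; rewrite (nth_map x0) ?size_enum_ord //.
  by rewrite -[i in RHS](nth_enum_ord x0) // eq_sym.
congr (_ || _).
  by case: j jn => [|j] jn //=; rewrite E ?eqSS //; lia.
case: (ltnP j.+1 n) => jn1; first by rewrite E.
rewrite nth_default; last by rewrite size_map size_enum_ord.
by rewrite gtn_eqF // (leq_trans (ltn_ord z)).
Qed.

(** A fort of a path contains the first vertex: otherwise emptiness would spread from that end. *)
Lemma path_fortE n (F : {set 'I_n}) :
  fort (@path_graph n) F =
    fort_bits false (trace F (enum 'I_n)) && head false (trace F (enum 'I_n)).
Proof.
have cP := chain_fortP F (path_chain n).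
apply/fortP/andP => [[F0 fF]|[/cP fF hF]]; split.
- by apply/cP => x _; apply: fF.
- apply: contraNT F0 => hF; have := fort_bits_false_head _ hF.
  rewrite size_map => E; apply/eqP/setP => x; rewrite inE.
  have : x \in enum 'I_n by rewrite mem_enum.
  have /E/(congr1 (fun s => true \in s)) : fort_bits false (trace F (enum 'I_n)).
    by apply/cP => y _; apply: fF.
  rewrite mem_nseq andbF => /mapP NF xn; apply/negP => xF.
  by apply: NF; exists x.
- apply: contraTneq hF => ->; rewrite /trace.
  by case: (enum _) => //= a s; rewrite inE.
- by move=> x xF; apply: fF; rewrite ?mem_enum.
Qed.

Lemma card_minimal_path n : num_path_forts n%:Z = count_bits minimal_bits n.
Proof.
case: n => [|n]; first by rewrite count_bits0.
rewrite -[LHS]/#|minimal_forts (@path_graph n.+1)|.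
(* The path is treated as a partition into one sequence, so that the lemmas on traces apply. *)
set m := n.+1; pose q (_ : unit) := enum 'I_m.
have q_uniq i : uniq (q i) by apply: enum_uniq.
have q_cover x : exists i, x \in q i by exists tt; rewrite mem_enum.
have q_disj i j x : x \in q i -> x \in q j -> i = j by case: i j => -[].
have := card_trace q_uniq q_disj q_cover (fun=> minimal_bits).
rewrite (bigD1 tt) //= big1 => [|[] //]; rewrite muln1 size_enum_ord => <-.
apply: eq_card => F; rewrite !inE; apply/minsetP/forallP => [[]|/(_ tt) Fmin].
  rewrite path_fortE => /andP[F_ok F_hd] F_min i.
  have [t t_min tF] := minimal_bits_exists F_ok F_hd.
  have [|F' F'E] := trace_surj q_uniq q_disj (t := fun=> t).
    by move=> j; move: tF; rewrite all2E size_map => /andP[/eqP].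
  rewrite -(F_min F') ?F'E //.
    by rewrite path_fortE (F'E tt) minimal_bits_fort ?minimal_bits_head.
  by apply/(trace_subset q_cover) => -[]; rewrite F'E.
split; first by rewrite path_fortE minimal_bits_fort ?minimal_bits_head.
move=> F'; rewrite path_fortE => /andP[F'_ok F'_hd] /(trace_subset q_cover) F'F.
by apply: (trace_inj q_cover) => i; apply: minimal_bits_min.
Qed.

(** This lets a leg starting with a member survive unchanged when the centre is removed from the
    fort. *)
Lemma fort_bits_head b s : head false s -> fort_bits b s = fort_bits true s.
Proof. by case: s => [|[] s]. Qed.

Lemma card_sum_bool (X : finType) (A : pred X) :
  #|[set x | A x]| = \sum_x A x.
Proof. by rewrite -sum1dep_card big_mkcond; apply: eq_bigr => x _; case: (A x). Qed.

(** Turns a choice among mutually exclusive cases into a sum of indicators, ready for counting. *)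
Lemma sum_bool_unique (X : finType) (P A : pred X) :
    (forall x y, P x -> P y -> A x -> A y -> x = y) ->
  \sum_(x | P x) A x = [exists x, P x && A x] :> nat.
Proof.
move=> A1; case: existsP => [[x /andP[Px Ax]]|nA]; last first.
  by apply: big1 => x Px; case Ax: (A x) => //; case: nA; exists x; rewrite Px.
rewrite (bigD1 x) //= Ax big1 ?addn0 // => y /andP[Py yx].
by case Ay: (A y) => //; rewrite (A1 _ _ Px Py) ?eqxx in yx.
Qed.

(** * Minimal forts of a centre with chains attached *)

Section Legs.
Variables (T : finType) (e : rel T) (k : nat) (v : T) (p : 'I_k -> seq T).
Hypotheses (p_chain : forall i, chain e (Some v) (p i))
  (p_gt0 : forall i, 0 < size (p i))
  (p_disj : forall i j x, x \in p i -> x \in p j -> i = j)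
  (p_cover : forall x, x != v -> exists i, x \in p i)
  (v_nbr : forall z, e v z = [exists i, z == head v (p i)]).
Implicit Types F : {set T}.

(** The extra index [None] carries the centre, so that the sequences partition all vertices. *)
Definition legs (o : option 'I_k) : seq T := if o is Some i then p i else [:: v].

Lemma v_notin_leg i : v \notin p i.
Proof.
have [_ [+ _]] := p_chain i; apply: contra => vp.
by apply/mapP; exists v.
Qed.

Lemma legs_uniq o : uniq (legs o).
Proof. by case: o => [i|] //=; have [] := p_chain i. Qed.

Lemma legs_disj o o' x : x \in legs o -> x \in legs o' -> o = o'.
Proof.
case: o o' => [i|] [j|] //=; rewrite ?inE.
- by move=> /p_disj H /H ->.
- by move=> + /eqP xv; rewrite xv (negbTE (v_notin_leg i)).
- by move=> /eqP ->; rewrite (negbTE (v_notin_leg j)).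
Qed.

Lemma legs_cover x : exists o, x \in legs o.
Proof.
have [->|/p_cover[i xi]] := eqVneq x v; first by exists None; rewrite inE.
by exists (Some i).
Qed.

Lemma spider_trace_surj b (t : 'I_k -> bitseq) :
    (forall i, size (t i) = size (p i)) ->
  exists F, (v \in F) = b /\ forall i, trace F (p i) = t i.
Proof.
move=> t_size; pose t' o := if o is Some i then t i else [:: b].
have [|F FE] := trace_surj legs_uniq legs_disj (t := t'); first by case.
by exists F; split=> [|i]; [case: (FE None) | apply: (FE (Some i))].
Qed.

Lemma spider_subset F F' :
  reflect ((v \in F -> v \in F') /\
           forall i, all2 implb (trace F (p i)) (trace F' (p i)))
          (F \subset F').
Proof.
apply: (iffP (trace_subset legs_cover _ _)) => [H|[vF H]].
  split=> [|i]; last exact: (H (Some i)).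
  by have := H None; rewrite /= andbT => /implyP.
by case=> [i|] //=; rewrite andbT; apply/implyP.
Qed.

Lemma spider_trace_inj F F' :
  (v \in F) = (v \in F') -> (forall i, trace F (p i) = trace F' (p i)) -> F = F'.
Proof.
move=> vE FE; apply: (trace_inj legs_cover) => -[i|] //=.
by rewrite /trace /= vE.
Qed.

Definition leg_config b (A : 'I_k -> pred bitseq) F : bool :=
  ((v \in F) == b) && [forall i, A i (trace F (p i))].

Lemma card_leg_config b A : \sum_F leg_config b A F =
  \prod_i count_bits (A i) (size (p i)).
Proof.
pose A' o := if o is Some i then A i else pred1 [:: b].
have := card_trace legs_uniq legs_disj legs_cover A'.
(* The centre contributes a factor 1, its only bit being prescribed. *)
rewrite (bigD1 None) //= (count_bits_nseq 1 b) mul1n => E.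
rewrite -card_sum_bool.
have -> : \prod_i count_bits (A i) (size (p i)) =
          \prod_(o | o != None) count_bits (A' o) (size (legs o)).
  by rewrite (reindex_omap Some id) => [|[i|]] //=; apply: eq_bigl => i; rewrite eqxx.
rewrite -E; apply: eq_card => F; rewrite !inE.
apply/andP/forallP => [[/eqP vF /forallP H] [i|] //=|H].
  by rewrite /trace /= vF eqxx.
split; first by have := H None; rewrite /= eqseq_cons andbT.
by apply/forallP => i; apply: (H (Some i)).
Qed.

Definition heads F : {set 'I_k} := [set i | head false (trace F (p i))].

Lemma card_heads F : #|neighbors e v :&: F| = #|heads F|.
Proof.
have hp i : head v (p i) \in p i by case: (p i) (p_gt0 i) => //= x s; rewrite mem_head.
have hE i : head false (trace F (p i)) = (head v (p i) \in F).
  by case: (p i) (p_gt0 i).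
rewrite -(@card_in_imset _ _ (fun i => head v (p i)) (heads F)); last first.
  by move=> i j _ _ E; apply: (@p_disj _ _ (head v (p i))); rewrite // E.
apply: eq_card => z; rewrite !inE v_nbr.
apply/andP/imsetP => [[/existsP[i /eqP ->] hF]|[i]].
  by exists i; rewrite // inE hE.
rewrite inE hE => hF ->; split=> //.
by apply/existsP; exists i.
Qed.

Lemma spider_fortP F : reflect
  [/\ F != set0, forall i, fort_bits (v \in F) (trace F (p i)) &
      v \notin F -> #|heads F| != 1]
  (fort e F).
Proof.
apply: (iffP (fortP _ _)) => [[F0 H]|[F0 H vF]]; split=> //.
- by move=> i; apply/(chain_fortP _ (p_chain i)) => x _; apply: H.
- by rewrite -card_heads; apply: H.
move=> x; have [->|/p_cover[i xi]] := eqVneq x v; first by rewrite card_heads.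
by move: x xi; apply/(chain_fortP _ (p_chain i))/H.
Qed.

Lemma heads_neq0 F i : i \in heads F -> F != set0.
Proof.
rewrite inE => iF; apply: contraTneq iF => ->.
by case: (p i) => //= x s; rewrite inE.
Qed.

Definition two_legs (ij : 'I_k * 'I_k) : 'I_k -> pred bitseq :=
  fun m => if (m == ij.1) || (m == ij.2) then minimal_bits
           else pred1 (nseq (size (p m)) false).

Lemma two_legs_heads b i j F : leg_config b (two_legs (i, j)) F ->
  heads F = [set i; j].
Proof.
case/andP=> _ /forallP H; apply/setP => m; rewrite !inE; have := H m.
rewrite /two_legs /=; case: ifP => _; first by move/minimal_bits_head.
by move=> /eqP ->; case: (p m).
Qed.

Lemma two_legs_fort i j F : i != j -> leg_config false (two_legs (i, j)) F ->
  fort e F.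
Proof.
move=> ij cF; have hF := two_legs_heads cF.
case/andP: cF => /eqP vF /forallP H; apply/spider_fortP; split.
- by apply: (@heads_neq0 _ i); rewrite hF !inE eqxx.
- move=> m; rewrite vF; have := H m; rewrite /two_legs /=.
  case: ifP => _; first exact: minimal_bits_fort.
  by move=> /eqP ->; apply: fort_bits_nseq.
- by rewrite hF cards2 ij.
Qed.

(** Drop the centre, shrink the legs [i] and [j] to minimal patterns and empty all the others. The
    centre keeps two neighbours in the set, hence the result is still a fort. *)
Lemma two_legs_exists i j F : i != j -> fort e F ->
    i \in heads F -> j \in heads F ->
  exists2 F', leg_config false (two_legs (i, j)) F' & F' \subset F.
Proof.
move=> ij /spider_fortP[_ F_ok _]; rewrite !inE => iF jF.
have ok m : head false (trace F (p m)) -> fort_bits false (trace F (p m)).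
  by move=> hm; have := F_ok m; rewrite !(fort_bits_head _ hm).
have /fin_all_exists [t tP] m : exists t : bitseq,
    two_legs (i, j) m t && all2 implb t (trace F (p m)).
  rewrite /two_legs /=; case: ifP => [mij|_].
    have hm : head false (trace F (p m)) by case/orP: mij => /eqP ->.
    by have [t tm tF] := minimal_bits_exists (ok m hm) hm; exists t; rewrite tm.
  exists (nseq (size (p m)) false); rewrite /= eqxx /=.
  by elim: (p m) => //=.
have [|F' [vF' F'E]] := @spider_trace_surj false t.
  by move=> m; have /andP[_] := tP m; rewrite all2E size_map => /andP[/eqP].
exists F'.
  by rewrite /leg_config vF' eqxx; apply/forallP => m; rewrite F'E; case/andP: (tP m).
by apply/spider_subset; split=> [|m]; rewrite ?vF' // F'E; case/andP: (tP m).
Qed.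

Lemma trace_set0 (s : seq T) : trace set0 s = nseq (size s) false.
Proof. by elim: s => //= x s ->; rewrite inE. Qed.

Lemma heads_subset F F' : F \subset F' -> heads F \subset heads F'.
Proof.
move=> /spider_subset[_ FF']; apply/subsetP => i; rewrite !inE.
by have := FF' i; case: (p i) => //= x s /andP[/implyP].
Qed.

Lemma fort_leg_empty F i : fort e F -> v \notin F -> i \notin heads F ->
  trace F (p i) = nseq (size (p i)) false.
Proof.
move=> /spider_fortP[_ F_ok _] vF; rewrite inE => iF.
rewrite -[size (p i)](size_map (mem F)); apply: fort_bits_false_head => //.
by have := F_ok i; rewrite (negbTE vF).
Qed.

Lemma fort_heads_gt1 F : fort e F -> v \notin F -> 1 < #|heads F|.
Proof.
move=> fF vF; have /spider_fortP[F0 _ /(_ vF)] := fF.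
rewrite ltn_neqAle eq_sym => ->; rewrite lt0n cards_eq0.
apply: contraNneq F0 => hF0; apply/eqP; apply: spider_trace_inj => [|i].
  by rewrite inE (negbTE vF).
by rewrite trace_set0 fort_leg_empty // hF0 inE.
Qed.

Lemma card_gt1_lt (A : {set 'I_k}) : 1 < #|A| ->
  exists i j, [/\ i \in A, j \in A & i < j].
Proof.
case/card_gt1P => i [j [iA jA ij]].
case: (ltngtP i j) => [lij|lij|/val_inj E]; [by exists i, j|by exists j, i|].
by rewrite E eqxx in ij.
Qed.

Lemma minimal_fort_with_center F : v \in F ->
  (F \in minimal_forts e) =
    [forall i, minimal_tail (trace F (p i))] && (#|heads F| <= 1).
Proof.
move=> vF; rewrite inE; apply/minsetP/andP => [[fF minF]|[/forallP F_min hF]].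
  split; last first.
    (* Two legs starting with a member would contain a fort avoiding [v], against minimality. *)
    rewrite leqNgt; apply/negP => /card_gt1_lt[i [j [iF jF lij]]].
    have ij : i != j by apply: contraTneq lij => ->; rewrite ltnn.
    have [F' cF' F'F] := two_legs_exists ij fF iF jF.
    move: vF; rewrite -(minF F' (two_legs_fort ij cF') F'F).
    by case/andP: cF' => /eqP ->.
  have /spider_fortP[_ F_ok _] := fF; rewrite vF in F_ok.
  have /fin_all_exists [t tP] i : exists t : bitseq,
      minimal_tail t && all2 implb t (trace F (p i)).
    by have [t tm tF] := minimal_tail_exists (F_ok i); exists t; rewrite tm.
  have [|F' [vF' F'E]] := @spider_trace_surj true t.
    by move=> i; have /andP[_] := tP i; rewrite all2E size_map => /andP[/eqP].
  have <- : F' = F.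
    apply: minF; last first.
      by apply/spider_subset; split=> // i; rewrite F'E; case/andP: (tP i).
    apply/spider_fortP; rewrite vF'; split=> //.
      by apply/set0Pn; exists v.
    by move=> i; rewrite F'E minimal_tail_fort //; case/andP: (tP i).
  by apply/forallP => i; rewrite F'E; case/andP: (tP i).
split.
  apply/spider_fortP; rewrite vF; split=> //; first by apply/set0Pn; exists v.
  by move=> i; apply: minimal_tail_fort.
move=> F' fF' F'F; have [vF'|vF'] := boolP (v \in F').
  have /spider_fortP[_ F'_ok _] := fF'; have /spider_subset[_ trF'F] := F'F.
  apply: spider_trace_inj; first by rewrite vF vF'.
  by move=> i; apply: minimal_tail_min => //; rewrite -{1}vF'.
(* A smaller fort avoiding [v] would need at least two legs starting with a member. *)
have := leq_trans (subset_leq_card (heads_subset F'F)) hF.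
by rewrite leqNgt fort_heads_gt1.
Qed.

Lemma minimal_fort_without_center F : v \notin F ->
  (F \in minimal_forts e) =
    [exists ij : 'I_k * 'I_k,
      (ij.1 < ij.2) && leg_config false (two_legs ij) F].
Proof.
move=> vF; rewrite inE; apply/minsetP/existsP => [[fF minF]|[[i j] /andP[/= lij cF]]].
  have [i [j [iF jF lij]]] := card_gt1_lt (fort_heads_gt1 fF vF).
  have ij : i != j by apply: contraTneq lij => ->; rewrite ltnn.
  have [F' cF' F'F] := two_legs_exists ij fF iF jF.
  by exists (i, j); rewrite lij -(minF F' (two_legs_fort ij cF') F'F).
have ij : i != j by apply: contraTneq lij => ->; rewrite ltnn.
split; first exact: two_legs_fort cF.
move=> F' fF' F'F.
have vF' : v \notin F' by apply: contra vF; apply/subsetP.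
(* A fort inside [F] meets only these two legs, and avoiding [v] it must meet at least two. *)
have hF' : heads F' = [set i; j].
  apply/eqP; rewrite eqEcard -{1}(two_legs_heads cF) heads_subset //.
  by rewrite cards2 ij fort_heads_gt1.
have /spider_fortP[_ F'_ok _] := fF'; have /spider_subset[_ trF'F] := F'F.
case/andP: cF => _ /forallP H; apply: spider_trace_inj => [|m].
  by rewrite (negbTE vF) (negbTE vF').
have := H m; rewrite /two_legs /=; case: ifP => mij.
  move=> F_min; apply: minimal_bits_min => //.
    by have := F'_ok m; rewrite (negbTE vF').
  by have /setP/(_ m) := hF'; rewrite !inE mij.
by move=> /eqP ->; rewrite fort_leg_empty // hF' !inE mij.
Qed.

(** The two kinds of legs below a centre in the fort: they lead to the factors for [P_(l-1)] and
    [P_(l-2)] respectively. *)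
Definition skip_leg : pred bitseq := fun s => minimal_tail s && ~~ head false s.
Definition take_leg : pred bitseq := fun s => minimal_tail s && head false s.

(** Having at most one head means that [heads F] is empty or equals [[set i]] for a single [i];
    these cases exclude each other, so the indicators add up. *)
Lemma minimal_fort_with_centerE F : v \in F ->
  (F \in minimal_forts e) = leg_config true (fun=> skip_leg) F
    + \sum_i leg_config true (fun m => if m == i then take_leg else skip_leg) F
  :> nat.
Proof.
move=> vF; rewrite minimal_fort_with_center //.
have config1 i : leg_config true (fun m => if m == i then take_leg else skip_leg) F
    = [forall m, minimal_tail (trace F (p m))] && (heads F == [set i]).
  rewrite /leg_config vF eqxx; apply/forallP/andP => [H|[/forallP F_min /eqP hF] m].
    split; first by apply/forallP => m; have := H m; case: ifP => _ /andP[].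
    apply/eqP/setP => m; rewrite !inE; have := H m.
    by case: ifP => _ /andP[_] // /negbTE.
  have /setP/(_ m) := hF; rewrite !inE.
  by case: ifP => _ hm; rewrite /take_leg /skip_leg F_min hm.
have config0 : leg_config true (fun=> skip_leg) F
    = [forall m, minimal_tail (trace F (p m))] && (heads F == set0).
  rewrite /leg_config vF eqxx; apply/forallP/andP => [H|[/forallP F_min /eqP hF] m].
    split; first by apply/forallP => m; have /andP[] := H m.
    by apply/eqP/setP => m; rewrite !inE; have /andP[_ /negbTE] := H m.
  by have /setP/(_ m) := hF; rewrite !inE /skip_leg F_min => ->.
rewrite config0 (eq_bigr _ (fun i _ => congr1 nat_of_bool (config1 i))).
case: [forall m, _] => /=; last by rewrite big1.
rewrite sum_bool_unique; last by move=> i j _ _ /eqP -> /eqP/set1_inj.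
rewrite leq_eqVlt ltnS leqn0 cards_eq0 orbC.
have [->|hF] := eqVneq (heads F) set0.
  rewrite /= -[1 in LHS]addn0; congr (_ + _); apply/esym/eqP; rewrite eqb0.
  by apply/existsP => -[i] /eqP/setP/(_ i); rewrite !inE eqxx.
congr nat_of_bool; apply/cards1P/existsP => [[i ->]|[i /eqP ->]]; exists i => //=.
Qed.

Lemma minimal_fortE F :
  (F \in minimal_forts e) = leg_config true (fun=> skip_leg) F
    + \sum_i leg_config true (fun m => if m == i then take_leg else skip_leg) F
    + \sum_(ij : 'I_k * 'I_k | ij.1 < ij.2) leg_config false (two_legs ij) F
  :> nat.
Proof.
have [vF|vF] := boolP (v \in F).
  rewrite minimal_fort_with_centerE // [X in _ = _ + X]big1 ?addn0 // => ij _.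
  by rewrite /leg_config vF.
have config1 A : leg_config true A F = false by rewrite /leg_config (negbTE vF).
rewrite minimal_fort_without_center // config1 [in RHS]big1 ?add0n; last first.
  by move=> i _; rewrite config1.
rewrite sum_bool_unique // => -[i j] [i' j'] /= lij lij' cF cF'.
(* The set of heads determines the pair, because its components are ordered. *)
have /setP hm : [set i; j] = [set i'; j'].
  by rewrite -(two_legs_heads cF) (two_legs_heads cF').
have := hm i; have := hm j; have := hm i'; have := hm j'.
rewrite !inE !eqxx ?orbT -!val_eqE /= => E1 E2 E3 E4.
by congr (_, _); apply: val_inj => /=; lia.
Qed.

(** Sum the indicator identity over all [F] and exchange the sums; each configuration then counts as
    a product over the legs. *)
Lemma card_minimal_forts : #|minimal_forts e| =
  \prod_i count_bits skip_leg (size (p i))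
  + \sum_(i < k) (count_bits take_leg (size (p i))
            * \prod_(j < k | j != i) count_bits skip_leg (size (p j)))
  + \sum_(i < k) \sum_(j < k | i < j)
      count_bits minimal_bits (size (p i)) * count_bits minimal_bits (size (p j)).
Proof.
have -> : #|minimal_forts e| = \sum_F (F \in minimal_forts e).
  by rewrite -card_sum_bool; apply: eq_card => F; rewrite [RHS]inE.
rewrite (eq_bigr _ (fun F _ => minimal_fortE F)) !big_split /= card_leg_config.
congr (_ + _ + _).
  rewrite exchange_big; apply: eq_bigr => i _; rewrite card_leg_config.
  rewrite (bigD1 i) //= eqxx; congr (_ * _).
  by apply: eq_bigr => j /negbTE ->.
rewrite exchange_big [RHS]pair_big_dep /=; apply: eq_bigr => -[i j] /= lij.
have ji : j != i by apply: contraTneq lij => ->; rewrite ltnn.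
rewrite card_leg_config (bigD1 i) //= (bigD1 j) //= big1.
  by rewrite /two_legs /= !eqxx orbT muln1.
move=> m /andP[mi mj].
by rewrite /two_legs /= (negbTE mi) (negbTE mj) count_bits_nseq.
Qed.

End Legs.

(** * The legs of a spider are chains partitioning the other vertices *)

Section Avoiding.
Variables (T : finType) (e : rel T).
Hypothesis e_sym : symmetric e.

(** Cutting the edges at [v] makes each leg closed under adjacency, so that legs can be compared by
    connectivity. *)
Definition avoiding (v : T) : rel T := [rel x y | [&& e x y, x != v & y != v]].

Lemma avoiding_sym v : symmetric (avoiding v).
Proof. by move=> x y; rewrite /avoiding /= e_sym [(x != v) && _]andbC. Qed.

(* A walk leaving [v] and never turning back cannot close up, so it goes on
   until it reaches a pendant vertex. *)
Lemma avoiding_pendant v z s : irreflexive e -> acyclic_graph e ->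
    path e z s -> uniq (z :: s) -> 0 < size s -> last z s = v ->
  exists z', [/\ pendant e z', z' != v & connect (avoiding v) z z'].
Proof.
(* The walk is stored backwards, from its current tip [z] to [v]; each step prepends a vertex, so
   this difference decreases. *)
move=> e_irr e_acyc; have [n] := ubnP (#|T| - size s).
elim: n z s => // n IH z [//|w s] s_n z_path z_uniq _ z_last.
have vws : v \in w :: s by rewrite -z_last /= mem_last.
have zv : z != v by apply: contraTneq vws => <-; case/andP: z_uniq.
have zw : e z w by case/andP: z_path.
have [zp|zp] := boolP (pendant e z); first by exists z; rewrite zv connect0.
have [y [zy yw]] : exists y, e z y /\ y != w.
  case: (pickP [pred y | e z y && (y != w)]) => [y /andP[]|no]; first by exists y.
  case/eqP: zp; rewrite /degree -(cards1 w); apply: eq_card => y; rewrite !inE.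
  by have := no y; rewrite /=; case: eqP => [->|_] //=; rewrite andbT.
have yz : y != z by apply: contraTneq zy => ->; rewrite e_irr.
have ys : y \notin z :: w :: s.
  rewrite !inE (negbTE yz) (negbTE yw) /=; apply/negP => ys.
  (* The walk from [z] back to [y], closed by the edge [z y], is a cycle with at least the three
     vertices [z], [w], [y]. *)
  case/splitPr: ys z_path z_uniq {IH s_n z_last vws} => s1 s2.
  rewrite -cat_rcons -cat_cons cat_path -!cat_cons cat_uniq => /andP[c1 _] /andP[c2 _].
  have /negP : ~~ ucycleb e (z :: w :: rcons s1 y).
    by apply: e_acyc; rewrite /= size_rcons.
  apply.
  rewrite /ucycleb c2 andbT /cycle rcons_path /= last_rcons (e_sym y) zy andbT.
  by move: c1.
have yv : y != v by apply: contraNneq ys => ->; rewrite inE vws orbT.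
have [|||||z' [z'p z'v yz']] := IH y (z :: w :: s); rewrite //=.
- have /card_uniqP s_card : uniq [:: y, z, w & s] by rewrite cons_uniq ys.
  have : (size s).+3 <= #|T| by rewrite -[_.+3]s_card max_card.
  by move: s_n => /=; move: #|T| => m; clear; lia.
- by apply/andP; split; [rewrite e_sym|].
- by rewrite ys.
exists z'; split=> //; apply: connect_trans yz'; apply: connect1.
by rewrite /avoiding /= zy zv.
Qed.

End Avoiding.

Section PathsAreChains.
Variables (T : finType) (e : rel T) (v : T) (s : seq T).
Hypotheses (e_sym : symmetric e) (s_path : path e v s) (s_uniq : uniq (v :: s)).

Lemma path_inner_neighbors x0 j : j.+1 < size s ->
  [set nth x0 (v :: s) j; nth x0 s j.+1] \subset neighbors e (nth x0 s j) /\
  nth x0 (v :: s) j != nth x0 s j.+1.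
Proof.
move=> js; have /(pathP x0) sE := s_path; split.
  apply/subsetP => y; rewrite !inE => /orP[] /eqP ->.
    by rewrite e_sym; apply: sE; apply: ltnW.
  exact: (sE j.+1).
rewrite -[nth x0 s j.+1]/(nth x0 (v :: s) j.+2) nth_uniq //=; lia.
Qed.

(** Every earlier vertex of [s] has two distinct neighbours on the path. *)
Lemma path_pendant_last x : x \in s -> pendant e x -> x = last v s.
Proof.
move=> xs xp; have js : index x s < size s by rewrite index_mem.
have [js1|js1] := ltnP (index x s).+1 (size s); last first.
  by rewrite -[LHS](nth_index v xs) -nth_last; congr nth; lia.
have [/subset_leq_card + N2] := path_inner_neighbors v js1.
by rewrite cards2 N2 nth_index // -/(degree e x) (eqP xp).
Qed.

(** With degree at most 2, an inner vertex has no neighbours beyond its two on the path; the pendant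
    end has only its predecessor. *)
Lemma path_chain_of_degrees : (forall x, x \in s -> ~~ junction e x) ->
  pendant e (last v s) -> chain e (Some v) s.
Proof.
move=> s_deg s_last; have := s_uniq => /= /andP[vs s_u]; split=> //.
split; first by apply/mapP => -[x xs [vx]]; rewrite vx xs in vs.
move=> x0 j z js; rewrite -map_cons (nth_map x0) ?ltnS ?(ltnW js) //.
have /(pathP x0) sE := s_path.
have [js1|js1] := ltnP j.+1 (size s).
  rewrite (nth_map x0) //; have [sub N2] := path_inner_neighbors x0 js1.
  have /setP/(_ z) : [set nth x0 (v :: s) j; nth x0 s j.+1]
                     = neighbors e (nth x0 s j).
    apply/eqP; rewrite eqEcard sub cards2 N2.
    by rewrite leqNgt; apply/s_deg/mem_nth.
  by rewrite !inE => <-.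
rewrite [X in _ || (_ == X)]nth_default ?size_map // orbF.
have jE : nth x0 s j = last v s.
  have -> : j = (size s).-1 by lia.
  by rewrite nth_last; case: (s) js.
have /cards1P[w wE] := s_last; have inw y : e (last v s) y = (y == w).
  by have /setP/(_ y) := wE; rewrite !inE.
by have := sE j js; rewrite e_sym jE !inw => /eqP ->.
Qed.

End PathsAreChains.

Section ChainNeighbors.
Variables (T : finType) (e : rel T) (v : T) (s : seq T).
Hypothesis s_chain : chain e (Some v) s.

Lemma chain_neighbor x y : x \in s -> e x y -> (y == v) || (y \in s).
Proof.
have [_ [_ eE]] := s_chain => xs; rewrite -{1}(nth_index x xs) eE ?index_mem //.
have nthE L i : Some y == nth None (map Some L) i -> y \in L.
  move=> /eqP E; have : Some y \in map Some L.
    rewrite E; apply: mem_nth; rewrite ltnNge; apply: contraTN isT => iL.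
    by rewrite nth_default in E.
  by rewrite mem_map // => ? ? [].
by rewrite -map_cons => /orP[/nthE|/nthE ->]; rewrite ?orbT // inE.
Qed.

Lemma chain_neighbor_end x : x \in s -> e x v -> x = head v s.
Proof.
have [s_uniq [vs eE]] := s_chain => xs.
rewrite -{1}(nth_index x xs) eE ?index_mem // => /orP[|]; last first.
  move=> /eqP E; case/negP: vs; rewrite E mem_nth // size_map ltnNge.
  by apply/negP => js; rewrite nth_default ?size_map in E.
case E: (index x s) => [|j] /=.
  by move=> _; rewrite -nth0 -E nth_index.
move=> /eqP E'; case/negP: vs; rewrite E' mem_nth // size_map.
by rewrite ltnW // -E index_mem.
Qed.

Lemma chain_closed : symmetric e -> closed (avoiding e v) [in s].
Proof.
move=> e_sym; apply: (intro_closed (sym_connect_sym (avoiding_sym e_sym v))).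
move=> x y /and3P[exy _ /negbTE yv] xs.
by have := chain_neighbor xs exy; rewrite yv.
Qed.

End ChainNeighbors.

Section Spiders.
Variables (T : finType) (e : rel T) (k : nat) (l : 'I_k -> nat).
Variables (v : T) (u : 'I_k -> T).
Hypotheses (l_gt0 : forall i, 0 < l i) (spider_e : spider e l v u).

Lemma spider_legs : exists p : 'I_k -> seq T,
  [/\ forall i, chain e (Some v) (p i), forall i, size (p i) = l i,
      forall i j x, x \in p i -> x \in p j -> i = j,
      forall x, x != v -> exists i, x \in p i &
      forall z, e v z = [exists i, z == head v (p i)]].
Proof.
have [[[e_sym e_irr] e_conn e_acyc] u_inj jE pE /fin_all_exists[p pP]] := spider_e.
have p_size i : size (p i) = l i by have [] := pP i.
have p_gt0 i : 0 < size (p i) by rewrite p_size.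
have p_last i : last v (p i) = u i by have [] := pP i.
have p_path i : path e v (p i) by have [] := pP i.
have p_uniq i : uniq (v :: p i) by have [] := pP i.
have u_pend i : pendant e (u i) by rewrite pE codom_f.
have up i : u i \in p i.
  by rewrite -p_last; case: (p i) (p_gt0 i) => //= x s _; apply: mem_last.
have head_p i : head v (p i) \in p i.
  by case: (p i) (p_gt0 i) => //= x s _; apply: mem_head.
have vp i : v \notin p i by have /andP[] := p_uniq i.
have p_chain i : chain e (Some v) (p i).
  apply: path_chain_of_degrees => //; last by rewrite p_last.
  move=> x xp; rewrite jE; have [xv|//] := eqVneq x v; last by rewrite andbF.
  by rewrite xv (negbTE (vp i)) in xp.
have p_closed i := closed_connect (chain_closed (p_chain i) e_sym).
(* From a neighbour [z] of [v] some pendant vertex [u i] is reached without [v], so [z] lies on leg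
   [i], whose only vertex adjacent to [v] is the first. *)
have v_nbr z : e v z = [exists i, z == head v (p i)].
  apply/idP/existsP => [vz|[i /eqP ->]]; last first.
    by have := p_path i; case: (p i) (p_gt0 i) => //= x s _ /andP[].
  have zv : z != v by apply: contraTneq vz => ->; rewrite e_irr.
  have [|||//|z' [z'p z'v zz']] := @avoiding_pendant _ e e_sym v z [:: v] e_irr e_acyc.
  - by rewrite /= e_sym vz.
  - by rewrite /= inE zv.
  - by [].
  have /codomP[i z'E] : z' \in codom u by rewrite -pE.
  have zi : z \in p i by rewrite (p_closed i _ _ zz') z'E; apply: up.
  by exists i; apply/eqP; apply: (chain_neighbor_end (p_chain i) zi); rewrite e_sym.
exists p; split=> //.
- move=> i j x xi xj.
  have con y : y \in p i -> connect (avoiding e v) (head v (p i)) y.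
    have := p_path i; have := vp i; case: (p i) (p_gt0 i) => //= a s _.
    move=> vas /andP[_ as_path] ys; apply: (path_connect _ ys).
    apply/(pathP a) => m ms; have /(pathP a)/(_ m ms) em := as_path.
    rewrite /avoiding /= em /=; apply/andP; split; apply: contraNneq vas => <-.
      by apply: mem_nth; apply: ltnW.
    by rewrite inE mem_nth ?orbT.
  (* A shared vertex connects the two legs away from [v], which puts [u i] on leg [j]; being
     pendant, it is the end [u j]. *)
  have uij : u i \in p j.
    by rewrite -(p_closed j _ _ (con _ (up i))) (p_closed j _ _ (con _ xi)).
  apply: u_inj; rewrite -(p_last j).
  exact: path_pendant_last uij (u_pend i).
- move=> x xv; pose a := [pred x | (x == v) || [exists i, x \in p i]].
  (* No edge leaves the union of [v] and the legs, so by connectedness it is everything. *)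
  have a_closed : closed e a.
    apply: (intro_closed (sym_connect_sym e_sym)) => y z yz /orP[/eqP yv|].
      move: yz; rewrite yv v_nbr => /existsP[i /eqP ->].
      by rewrite inE; apply/orP; right; apply/existsP; exists i.
    case/existsP => i yi; have /orP[zv|zi] := chain_neighbor (p_chain i) yi yz.
      by rewrite inE zv.
    by rewrite inE; apply/orP; right; apply/existsP; exists i.
  have := closed_connect a_closed (e_conn v x).
  by rewrite !inE eqxx (negbTE xv) => /esym/existsP.
Qed.

End Spiders.

(** * Translation into fort numbers of paths *)

Lemma count_skip_leg n : 0 < n ->
  count_bits skip_leg n = num_path_forts (n%:Z - 1)%R.
Proof.
case: n => // n _; rewrite count_minimal_tail_skip.
have -> : (n.+1%:Z - 1 = n)%R by lia.
by rewrite card_minimal_path.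
Qed.

Lemma count_take_leg n : 0 < n ->
  count_bits take_leg n = num_path_forts (n%:Z - 2)%R.
Proof.
(* For a leg of length 1 the index is -1, where the convention gives 1. *)
case: n => // -[|n] _; first by rewrite count_minimal_tail_take1.
rewrite count_minimal_tail_take.
have -> : (n.+2%:Z - 2 = n)%R by lia.
by rewrite card_minimal_path.
Qed.

Theorem theorem4p11 (T : finType) (e : rel T) (k : nat) (l : 'I_k -> nat)
    (v : T) (u : 'I_k -> T) (hk : 2 <= k) (hl : forall i, 1 <= l i)
    (hS : spider e l v u) :
  #|minimal_forts e| =
    \prod_(i < k) num_path_forts ((l i)%:Z - 1)%R
    + \sum_(i < k) (num_path_forts ((l i)%:Z - 2)%R
                    * \prod_(j < k | j != i) num_path_forts ((l j)%:Z - 1)%R)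
    + \sum_(i < k) \sum_(j < k | i < j)
        num_path_forts (l i)%:Z * num_path_forts (l j)%:Z.
Proof.
have [p [p_chain p_size p_disj p_cover v_nbr]] := spider_legs hl hS.
have p_gt0 i : 0 < size (p i) by rewrite p_size.
rewrite (card_minimal_forts p_chain p_gt0 p_disj p_cover v_nbr).
have skipE i : count_bits skip_leg (size (p i)) = num_path_forts ((l i)%:Z - 1)%R.
  by rewrite p_size count_skip_leg.
congr (_ + _ + _); first by apply: eq_bigr.
  apply: eq_bigr => i _; rewrite p_size count_take_leg //; congr (_ * _).
  exact: eq_bigr.
by apply: eq_bigr => i _; apply: eq_bigr => j _; rewrite !card_minimal_path !p_size.
Qed.
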